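(* Let $d=2$ and let $\bar x\in\mathbf V$ be a fixed point of both $\mathbf S_1$ and $\mathbf S_2$. Assume that $\mathbf P_1,\mathbf P_2,\mathbf S_1,\mathbf S_2$ are continuously (Fréchet) differentiable in a neighborhood of $\bar x$, that $f$ is twice continuously (Fréchet) differentiable in a neighborhood of $\bar x$, and that for $i=1,2$ the operator $\bar{\mathbf P}_i\bar{\mathbf A}\bar{\mathbf P}_i$, considered as an operator on $T_i(\bar x)$, is invertible, with inverse $\bar{\mathbf B}_i$. Suppose in addition that (i) $\bar{\mathbf P}_1^{\bar{\mathbf A}}$ and $\bar{\mathbf P}_2^{\bar{\mathbf A}}$ commute; (ii) $\bar{\mathbf N}_i=0$ on $T_i(\bar x)$ for $i=1,2$. Then $$\rho(\mathbf S'(\bar x)\bar{\mathbf P})=\rho(\bar{\mathbf B}_2\bar{\mathbf N}_2\bar{\mathbf B}_1\bar{\mathbf N}_1\bar{\mathbf P}),$$ where $\rho$ denotes the spectral radius.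
   Context: Setting: $\mathbf V$ is a real Hilbert space and $f:\mathbf V\to\mathbb R$ is a $C^1$ function with gradient $\nabla f$. To every $x\in\mathbf V$ are attached closed subspaces $T_1(x),T_2(x)$ of $\mathbf V$ (possibly overlapping) and the subspace $T(x)=T_1(x)+T_2(x)$, also assumed closed. $\mathbf P_i(x)$ denotes the orthogonal projection onto $T_i(x)$, giving maps $\mathbf P_i:\mathbf V\to\mathcal L(\mathbf V)$, and $\mathbf P(x)$ is the orthogonal projection onto $T(x)$. The (nonlinear) operators $\mathbf S_i$ on $\mathbf V$, $i=1,2$, are such that $y=\mathbf S_i(x)$ satisfies $y\in x+T_i(x)$ and $\mathbf P_i(x)\nabla f(y)=0$. Put $\mathbf S=\mathbf S_2\circ\mathbf S_1$. Notation at $\bar x$: $\bar{\mathbf P}_i=\mathbf P_i(\bar x)$, $\bar{\mathbf P}=\mathbf P(\bar x)$; $\bar{\mathbf A}$ is the Hessian of $f$ at $\bar x$, viewed as a bounded self-adjoint operator on $\mathbf V$ (the derivative of $\nabla f$ at $\bar x$); $\bar{\mathbf B}_i=(\bar{\mathbf P}_i\bar{\mathbf A}\bar{\mathbf P}_i)^{-1}$, the inverse being taken on $T_i(\bar x)$; $\bar{\mathbf P}_i^{\bar{\mathbf A}}=\bar{\mathbf B}_i\bar{\mathbf P}_i\bar{\mathbf A}$; $\mathbf P_i'(\bar x;h)\in\mathcal L(\mathbf V)$ is the derivative of $\mathbf P_i$ at $\bar x$ applied to $h$; and $\bar{\mathbf N}_i$ is the linear operator on $\mathbf V$ given by $\bar{\mathbf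 N}_ih=\mathbf P_i'(\bar x;h)\nabla f(\bar x)$ (its values lie in $T_i(\bar x)$ under the assumptions made, so $\bar{\mathbf B}_i\bar{\mathbf N}_i$ is well defined). *)

(* Defs.v *)
From HB Require Import structures.
From mathcomp Require Import all_boot all_order all_algebra.
From mathcomp Require Import all_classical all_reals all_analysis.
From mathcomp.real_closed Require Import complex.

Set Implicit Arguments.
Unset Strict Implicit.
Unset Printing Implicit Defensive.

Import Order.TTheory GRing.Theory Num.Theory.
Import numFieldNormedType.Exports.

Local Open Scope classical_set_scope.
Local Open Scope ring_scope.

HB.mixin Record NormedModule_isInner (R : realType) V & NormedModule R V := {
  dot : V -> V -> R ;
  dotC : forall x y, dot x y = dot y x ;
  dotDl : forall x y z, dot (x + y) z = dot x z + dot y z ;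
  dotZl : forall (a : R) x y, dot (a *: x) y = a * dot x y ;
  dot_norm : forall x, dot x x = `|x| ^+ 2
}.

#[short(type="hilbertType")]
HB.structure Definition Hilbert (R : realType) :=
  {V of CompleteNormedModule R V & NormedModule_isInner R V}.

Definition blin_pred (R : realType) (V W : normedModType R) : {pred V -> W} :=
  [pred f : V -> W | `[< linear f /\ continuous f >] ].
Arguments blin_pred {R V W}.

Section Submod.
Context (R : realType) (V W : normedModType R).

Lemma blin_predP (f : V -> W) :
  reflect (linear f /\ continuous f) (f \in blin_pred).
Proof. exact: asboolP. Qed.

Lemma blin_submod_closed : submod_closed (@blin_pred R V W).
Proof.
split.
  apply/blin_predP; split; last exact: cst_continuous.
  by move=> a u v; rewrite /= scaler0 addr0.
move=> a f g /blin_predP[fl fc] /blin_predP[gl gc]; apply/blin_predP; split.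
  move=> b u v.
  change (a *: f (b *: u + v) + g (b *: u + v) =
          b *: (a *: f u + g u) + (a *: f v + g v)).
  by rewrite fl gl !scalerDr !scalerA (mulrC a b) addrACA.
move=> x; apply: (@continuousD R W V (a *: f) g) => //.
  by apply: continuousZl_tmp => //; exact: fc.
exact: gc.
Qed.

HB.instance Definition _ :=
  GRing.isSubmodClosed.Build R (V -> W) blin_pred blin_submod_closed.

End Submod.

Record blin (R : realType) (V W : normedModType R) := Blin {
  blin_val : V -> W ;
  blin_valP : blin_val \in blin_pred
}.

Notation "''L(' V , W )" := (blin V W) (format "''L(' V ,  W )") : type_scope.

Section Blin.
Context (R : realType) (V W : normedModType R).

HB.instance Definition _ := [isSub for @blin_val R V W].
HB.instance Definition _ := [Choice of blin V W by <:].
HB.instance Definition _ := [SubChoice_isSubLmodule of blin V W by <:].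


Definition blin_fun (f : 'L(V, W)) : V -> W := blin_val f.
Coercion blin_fun : blin >-> Funclass.

Lemma blinP (f g : 'L(V, W)) : f =1 g -> f = g.
Proof. by move=> fg; apply: val_inj; apply/funext. Qed.

Lemma blin_linear (f : 'L(V, W)) : linear f.
Proof. by case/blin_predP: (blin_valP f). Qed.

Lemma blin_continuous (f : 'L(V, W)) : continuous f.
Proof. by case/blin_predP: (blin_valP f). Qed.

HB.instance Definition _ (f : 'L(V, W)) :=
  GRing.isLinear.Build R V W _ (blin_fun f) (blin_linear f).

Lemma blinDE (f g : 'L(V, W)) x : (f + g) x = f x + g x. Proof. by []. Qed.
Lemma blinNE (f : 'L(V, W)) x : (- f) x = - f x. Proof. by []. Qed.
Lemma blinZE a (f : 'L(V, W)) x : (a *: f) x = a *: f x. Proof. by []. Qed.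
Lemma blin0E x : (0 : 'L(V, W)) x = 0. Proof. by []. Qed.

Definition opnorm (f : 'L(V, W)) : R :=
  sup [set `|f x| | x in [set x | `|x| <= 1]].

Lemma blin_bounded (f : 'L(V, W)) :
  exists M : R, forall x, `|f x| <= M * `|x|.
Proof.
have /linear_boundedP[M [_ fM]] : bounded_near f (nbhs (0 : V)).
  by apply: continuous_linear_bounded; exact: blin_continuous.
by exists (M + 1) => x; apply: fM; rewrite ltrDl.
Qed.

Lemma opnorm_has_sup (f : 'L(V, W)) :
  has_sup [set `|f x| | x in [set x | `|x| <= 1]].
Proof.
split; first by exists `|f 0|; exists 0 => //=; rewrite normr0.
have [M fM] := blin_bounded f; exists `|M| => _ [x /= x1 <-].
apply: le_trans (fM x) _; apply: le_trans (ler_norm _) _.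
by rewrite normrM normr_id ler_piMr.
Qed.

Lemma opnorm_ge0 (f : 'L(V, W)) : 0 <= opnorm f.
Proof.
apply: le_trans (normr_ge0 (f 0)) _.
apply: ub_le_sup; first by case: (opnorm_has_sup f).
by exists 0 => //=; rewrite normr0.
Qed.

Lemma le_opnorm (f : 'L(V, W)) x : `|f x| <= opnorm f * `|x|.
Proof.
have [->|x0] := eqVneq x 0; first by rewrite linear0 !normr0 mulr0.
have nx0 : 0 < `|x| by rewrite normr_gt0.
rewrite -ler_pdivrMr // mulrC -{1}(ger0_norm (normr_ge0 x)) -normfV -normrZ.
rewrite -linearZ; apply: ub_le_sup; first by case: (opnorm_has_sup f).
by eexists; last reflexivity; rewrite /= normrZ normfV normr_id mulVf ?gt_eqF.
Qed.

Lemma opnorm_le (f : 'L(V, W)) (M : R) : 0 <= M ->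
  (forall x, `|f x| <= M * `|x|) -> opnorm f <= M.
Proof.
move=> M0 fM; apply: ge_sup; first by case: (opnorm_has_sup f).
by move=> _ [x /= x1 <-]; apply: le_trans (fM x) _; rewrite ler_piMr.
Qed.

Lemma opnormD (f g : 'L(V, W)) : opnorm (f + g) <= opnorm f + opnorm g.
Proof.
apply: opnorm_le => [|x]; first by rewrite addr_ge0 ?opnorm_ge0.
rewrite mulrDl; apply: le_trans (ler_normD _ _) _.
by rewrite lerD ?le_opnorm.
Qed.

Lemma opnormZ_le a (f : 'L(V, W)) : opnorm (a *: f) <= `|a| * opnorm f.
Proof.
apply: opnorm_le => [|x]; first by rewrite mulr_ge0 ?opnorm_ge0.
by rewrite blinZE normrZ -mulrA ler_wpM2l ?le_opnorm.
Qed.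

Lemma opnormZ a (f : 'L(V, W)) : opnorm (a *: f) = `|a| * opnorm f.
Proof.
apply/eqP; rewrite eq_le opnormZ_le /=.
have [->|a0] := eqVneq a 0; first by rewrite normr0 mul0r opnorm_ge0.
rewrite -ler_pdivlMl ?normr_gt0 // -normfV.
by apply: le_trans (opnormZ_le _ _); rewrite scalerA mulVf // scale1r.
Qed.

Lemma opnorm_eq0 (f : 'L(V, W)) : opnorm f = 0 -> f = 0.
Proof.
move=> f0; apply: blinP => x; apply/eqP.
by rewrite blin0E -normr_le0; have := le_opnorm f x; rewrite f0 mul0r.
Qed.

HB.instance Definition _ :=
  Lmodule_isNormed.Build R 'L(V, W) opnormD opnormZ opnorm_eq0.

Lemma blin_normE (f : 'L(V, W)) : `|f| = opnorm f. Proof. by []. Qed.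

End Blin.

Section Composition.
Context (R : realType).

Lemma blin_comp_subproof (U V W : normedModType R)
    (g : 'L(V, W)) (f : 'L(U, V)) : g \o f \in blin_pred.
Proof.
apply/blin_predP; split; first by move=> a x y; rewrite /= !linearP.
by move=> x; apply: continuous_comp; exact: blin_continuous.
Qed.

Definition blin_comp (U V W : normedModType R)
  (g : 'L(V, W)) (f : 'L(U, V)) : 'L(U, W) := Blin (blin_comp_subproof g f).

Lemma blin_eval_subproof (V W : normedModType R) (v : V) :
  (fun f : 'L(V, W) => f v) \in blin_pred.
Proof.
have lin : linear (fun f : 'L(V, W) => f v) by [].
apply/blin_predP; split => //.
pose ev : {linear 'L(V, W) -> W} :=
  HB.pack (fun f : 'L(V, W) => f v) (GRing.isLinear.Build R _ _ _ _ lin).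
apply: (@bounded_linear_continuous R _ _ ev); apply/linear_boundedP.
exists `|v|; split => [|M vM f]; first exact: num_real.
apply: le_trans (le_opnorm f v) _.
by rewrite mulrC ler_wpM2r ?opnorm_ge0 // ltW.
Qed.

Definition blin_eval (V W : normedModType R) (v : V) : 'L('L(V, W), W) :=
  Blin (blin_eval_subproof W v).

End Composition.

Notation "g \oL f" := (blin_comp g f) (at level 50, left associativity).

Section Differentiability.
Context (R : realType) (V W : normedModType R).

(* The differential as a point of the normed space 'L(V, W); the default value
   0 is only taken where ['d f x] is not continuous, hence where [f] is not
   differentiable. *)
Definition fderiv (f : V -> W) (x : V) : 'L(V, W) := insubd 0 ('d f x : V -> W).

Lemma fderivE (f : V -> W) (x : V) :
  differentiable f x -> fderiv f x = 'd f x :> (V -> W).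
Proof.
move=> fx; rewrite /blin_fun /fderiv val_insubd.
case: blin_predP => // -[]; split; first exact: linearP.
exact: diff_continuous.
Qed.

Definition C1_at (f : V -> W) (x : V) : Prop :=
  differentiable f x /\ {for x, continuous (fderiv f)}.

Definition C1_near (f : V -> W) (x : V) : Prop := \forall y \near x, C1_at f y.

End Differentiability.

Definition C2_near (R : realType) (V W : normedModType R)
  (f : V -> W) (x : V) : Prop := C1_near f x /\ C1_near (fderiv f) x.

Section HilbertSpace.
Context (R : realType) (V : hilbertType R).

Definition closed_subspace (E : set V) : Prop :=
  [/\ E 0, forall (a : R) x y, E x -> E y -> E (a *: x + y) & closed E].

Definition subspace_sum (E F : set V) : set V :=
  [set u + v | u in E & v in F].

Definition orthogonal_projection (E : set V) (P : 'L(V, V)) : Prop :=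
  forall x, E (P x) /\ forall u, E u -> dot (x - P x) u = 0.

Definition is_gradient (f : V -> R) (grad : V -> V) : Prop :=
  forall x h, 'd f x h = dot (grad x) h.

(* Only the restriction of [B] to [E] matters; a bounded operator on a closed
   subspace [E] always extends to the whole space. *)
Definition inverse_on (E : set V) (M B : 'L(V, V)) : Prop :=
  forall u, E u -> [/\ E (B u), B (M u) = u & M (B u) = u].

End HilbertSpace.

Section Spectrum.
Context (R : realType) (V : normedModType R).

(* The complexification of [V] is carried by [V * V], the pair [(x, y)]
   standing for [x + i y]. *)
Definition cscale (l : R[i]) (z : V * V) : V * V :=
  (complex.Re l *: z.1 - complex.Im l *: z.2,
   complex.Im l *: z.1 + complex.Re l *: z.2).

Definition complexify (T : V -> V) (z : V * V) : V * V := (T z.1, T z.2).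

(* A two-sided inverse of a complex-linear map is complex-linear. *)
Definition resolvent_set (T : 'L(V, V)) : set R[i] :=
  [set l | exists S : 'L((V * V)%type, (V * V)%type),
    (forall z, S (cscale l z - complexify T z) = z) /\
    (forall z, cscale l (S z) - complexify T (S z) = z)].

Definition spectrum (T : 'L(V, V)) : set R[i] := ~` resolvent_set T.

(* The spectrum is bounded, and it is empty only if [V] is trivial, in which
   case this is [0]. *)
Definition spectral_radius (T : 'L(V, V)) : R :=
  sup [set ComplexField.Normc.normc l | l in spectrum T].

End Spectrum.

(* Main.v *)
From HB Require Import structures.
From mathcomp Require Import all_boot all_order all_algebra.
From mathcomp Require Import all_classical all_reals all_analysis.
From mathcomp Require Import lra.
From mathcomp.real_closed Require Import complex.
Require Import Defs.

Set Implicit Arguments.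
Unset Strict Implicit.
Unset Printing Implicit Defensive.

Import Order.TTheory GRing.Theory Num.Theory.
Import numFieldNormedType.Exports.

Local Open Scope classical_set_scope.
Local Open Scope ring_scope.

(** The argument has an analytic half and an algebraic half.

    Write [D_i] for the derivative of [S_i] at the fixed point [xbar].  Two
    identities hold for every [x]: the displacement [v x = S_i x - x] lies in
    [T_i x], that is [v x = P_i x (v x)], and [0 = P_i x (grad (S_i x))].
    Differentiating both by the product rule for operator application
    ([fderiv_blin_app]) at [xbar], where [v] vanishes, gives
    [D_i h - h \in T_i xbar] and [N_i h + P_i (A (D_i h)) = 0].  As [P_i A P_i]
    is invertible on [T_i xbar], these two relations determine [D_i]:
    [D_i = 1 - Q_i - M_i] with [Q_i = B_i P_i A] and [M_i = B_i N_i]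
    ([linearized_stepE]).  The chain rule needs [grad] to be differentiable,
    whereas the regularity assumption concerns the differential of [f].  The
    two are related by the Riesz map, a linear isometry, and a linear isometry
    defined on a complete space reflects differentiability
    ([isometry_reflects_differentiable]).

    Next, [Q_i] is a projection onto [T_i], and [M_i] maps into [T_i] and
    vanishes on it.  Because [Q_1] and [Q_2] commute, [1 - Q_1] maps
    [T = T_1 + T_2] into [T_2], and [1 - Q_2] maps it into [T_1]
    ([sub_commuting_projection_mem]).  Hence on [T] the products
    [(1 - Q_2) (1 - Q_1)], [M_2 (1 - Q_1)] and [M_1 (1 - Q_2)] vanish, and
    expanding gives [D_2 D_1 = (M_2 + Q_2 - 1) M_1].  Interchanging the two
    factors does not change the spectral radius ([spectral_radius_comp]), and
    in the other order the term [M_1 (Q_2 - 1)] disappears: what is left is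
    [M_1 M_2], and a second interchange leads to [M_2 M_1]
    ([spectral_radius_two_steps]).  All factors are composed with the
    projection [P] onto [T] so as to be operators on the whole space. *)

(** * Differentiation of operator-valued maps *)

Section Differentiation.
Context (R : realType).

Lemma blinD (V W : normedModType R) (F : 'L(V, W)) x y : F (x + y) = F x + F y.
Proof. exact: linearD. Qed.

Lemma blinB (V W : normedModType R) (F : 'L(V, W)) x y : F (x - y) = F x - F y.
Proof. exact: linearB. Qed.

Lemma blinN (V W : normedModType R) (F : 'L(V, W)) x : F (- x) = - F x.
Proof. exact: linearN. Qed.

Lemma isometry_continuous (V W : normedModType R) (J : {linear V -> W}) :
  (forall v, `|J v| = `|v|) -> continuous J.
Proof.
move=> iso; apply: bounded_linear_continuous; apply/linear_boundedP.
exists 1; split=> [|M M1 v]; first exact: num_real.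
by rewrite iso ler_peMl // ltW.
Qed.

(** The difference quotients of [g] are sent by the isometry [J] to those of
    [J \o g], which converge; so they are Cauchy, and completeness of [V]
    puts every value of the differential of [J \o g] in the range of [J].
    Pulling that differential back along [J] yields the differential of [g]. *)
Lemma isometry_reflects_differentiable (U : normedModType R)
    (V : completeNormedModType R) (W : normedModType R) (J : {linear V -> W})
    (g : U -> V) (x : U) :
  (forall v, `|J v| = `|v|) ->
  differentiable (J \o g) x -> differentiable g x.
Proof.
move=> iso dJg; set D := 'd (J \o g) x.
have Jinj v w : J v = J w -> v = w.
  move=> vw; apply/eqP; rewrite -subr_eq0 -normr_le0 -iso linearB vw subrr.
  by rewrite normr0.
have range_D k : exists v, J v = D k.
  pose q (t : R) := t^-1 *: ((g \o shift x) (t *: k) - g x).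
  have Jq : J (q t) @[t --> 0^'] --> D k.
    rewrite /D -deriveE //.
    have -> : (fun t => J (q t)) =
        (fun t => t^-1 *: ((J \o g \o shift x) (t *: k) - (J \o g) x)).
      by apply/funext => t; rewrite linearZ linearB.
    exact: diff_derivable.
  have /cauchy_cvgP/cvg_ex[v qv] : cauchy (q @ 0^').
    apply/cauchy_ballP => e e0.
    have e2 : 0 < e / 2 by rewrite divr_gt0.
    have /cvgrPdist_lt/(_ _ e2) near_Dk := Jq.
    pose close := [set y | `|D k - J y| < e / 2].
    exists (close, close) => [//|[y z] /= [y_close z_close]].
    rewrite -ball_normE /= -iso linearB.
    have -> : J y - J z = (D k - J z) - (D k - J y).
      by rewrite opprB [RHS]addrC addrA subrK.
    by apply: le_lt_trans (ler_normB _ _) _; rewrite [e]splitr ltrD.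
  exists v; apply: cvg_unique (Jq) => //.
  by apply: continuous_cvg qv; exact: isometry_continuous.
have [L JL] := choice range_D.
have L_linear : linear L.
  by move=> a u v; apply: Jinj; rewrite linearP !JL linearP.
pose dg : {linear U -> V} :=
  HB.pack L (GRing.isLinear.Build R _ _ _ _ L_linear).
have dg_cont : continuous dg.
  apply: bounded_linear_continuous; apply/linear_boundedP.
  have : bounded_near D (nbhs 0).
    by apply: continuous_linear_bounded; exact: diff_continuous.
  move=> /linear_boundedP; apply: filterS => M DM u.
  by rewrite -iso JL.
have dgE : g \o shift x = cst (g x) + dg +o_ 0 id.
  apply/eqaddoP => _/posnumP[e].
  have /diff_locally/eqaddoP/(_ e%:num) := dJg.
  move=> /(_ [gt0 of e%:num]).
  apply: filterS => h; rewrite -[in X in _ -> X]iso.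
  suff -> : J ((g \o shift x - (cst (g x) + dg)) h) =
      (J \o g \o shift x - (cst ((J \o g) x) + D)) h by [].
  have JdgE : J (dg h) = D h by exact: JL.
  transitivity (J (g (h + x) - (g x + dg h))); first by [].
  by rewrite linearB linearD JdgE.
by apply/diff_locallyP; rewrite (diff_unique dg_cont dgE).
Unshelve. all: by end_near. Qed.

Lemma cvg_blin_app (V W : normedModType R) (I : Type) (F : set_system I)
    {FF : Filter F} (Phi : I -> 'L(V, W)) (v : I -> V)
    (Phi0 : 'L(V, W)) (v0 : V) :
  Phi @ F --> Phi0 -> v @ F --> v0 -> Phi i (v i) @[i --> F] --> Phi0 v0.
Proof.
move=> cPhi cv.
have small : (Phi i - Phi0) (v i) @[i --> F] --> 0.
  apply/norm_cvg0P.
  apply: (@squeeze_cvgr _ _ _ _ (cst 0) (fun i => `|Phi i - Phi0| * `|v i|)).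
  - near=> i; apply/andP; split; first exact: normr_ge0.
    exact: (le_opnorm (Phi i - Phi0)).
  - exact: cvg_cst.
  - rewrite -(mul0r `|v0|); apply: cvgM; last exact: cvg_norm.
    by apply/norm_cvg0P; apply/subr_cvg0.
have limPhi0 : Phi0 (v i) @[i --> F] --> Phi0 v0.
  exact: (cvg_comp _ _ cv (@blin_continuous _ _ _ Phi0 v0)).
rewrite -(add0r (Phi0 v0)).
rewrite (_ : (fun i => Phi i (v i)) =
    (fun i => (Phi i - Phi0) (v i)) \+ (fun i => Phi0 (v i))).
  exact: cvgD.
by apply/funext => i; rewrite -[LHS](subrK (Phi0 (v i))).
Unshelve. all: by end_near. Qed.

Lemma fderiv_app (U W : normedModType R) (g : U -> W) x h :
  differentiable g x -> fderiv g x h = 'd g x h.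
Proof. by move=> /fderivE/(congr1 (fun F => F h)). Qed.

Lemma fderiv_comp (U V W : normedModType R) (g : U -> V) (k : V -> W) x :
  differentiable g x -> differentiable k (g x) ->
  fderiv (k \o g) x = fderiv k (g x) \oL fderiv g x.
Proof.
move=> dg dk; apply: blinP => h.
transitivity (fderiv k (g x) (fderiv g x h)); last by [].
rewrite fderiv_app; last exact: differentiable_comp.
by rewrite (fderiv_app _ dk) (fderiv_app _ dg) diff_comp.
Qed.

Lemma fderiv_cst (U W : normedModType R) (a : W) (x : U) :
  fderiv (cst a) x = 0.
Proof.
apply: blinP => h; rewrite fderiv_app; last exact: differentiable_cst.
by rewrite diff_cst.
Qed.

Lemma fderiv_cvg (U W : normedModType R) (g : U -> W) x h :
  differentiable g x ->
  t^-1 *: (g (t *: h + x) - g x) @[t --> 0^'] --> fderiv g x h.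
Proof.
by move=> dg; rewrite fderivE // -deriveE //; exact: diff_derivable.
Qed.

(** Only directional limits are taken: the difference quotient of
    [y |-> Phi y (v y)] splits into [(quotient of Phi) (v y)] and
    [Phi x (quotient of v)].  The differentiability of the product itself is a
    hypothesis, immediate when [w] is given in closed form. *)
Lemma fderiv_blin_app (U V W : normedModType R) (Phi : U -> 'L(V, W))
    (v : U -> V) (w : U -> W) (x h : U) :
  differentiable Phi x -> differentiable v x -> differentiable w x ->
  (forall y, w y = Phi y (v y)) ->
  fderiv w x h = fderiv Phi x h (v x) + Phi x (fderiv v x h).
Proof.
move=> dPhi dv dw wE.
have shift_cvg : t *: h + x @[t --> 0^'] --> x.
  rewrite -[X in _ --> X]add0r -(scale0r h); apply: cvgD; last exact: cvg_cst.
  apply: cvgZr_tmp; exact: nbhs_dnbhs.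
have v_cvg : v (t *: h + x) @[t --> 0^'] --> v x.
  by apply: cvg_comp shift_cvg _; exact: differentiable_continuous.
have lim1 : (t^-1 *: (Phi (t *: h + x) - Phi x)) (v (t *: h + x))
    @[t --> 0^'] --> fderiv Phi x h (v x).
  by apply: cvg_blin_app v_cvg; exact: fderiv_cvg.
have lim2 : Phi x (t^-1 *: (v (t *: h + x) - v x)) @[t --> 0^'] -->
    Phi x (fderiv v x h).
  by apply: cvg_blin_app (fderiv_cvg dv); exact: cvg_cst.
apply: (cvg_unique (@norm_hausdorff _ W) (fderiv_cvg dw)).
suff -> : (fun t => t^-1 *: (w (t *: h + x) - w x)) =
    (fun t => (t^-1 *: (Phi (t *: h + x) - Phi x)) (v (t *: h + x))) +
    (fun t => Phi x (t^-1 *: (v (t *: h + x) - v x))) by exact: cvgD.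
apply/funext => t; set y := t *: h + x.
transitivity (t^-1 *: (Phi y (v y) - Phi x (v y)) +
    Phi x (t^-1 *: (v y - v x))); last by [].
have -> : Phi x (t^-1 *: (v y - v x)) = t^-1 *: (Phi x (v y) - Phi x (v x)).
  by rewrite -linearB -linearZ.
by rewrite -scalerDr addrA subrK !wE.
Qed.

End Differentiation.

(** * Spectral radius of a product of two operators *)

Section SpectralRadius.
Context (R : realType).

Lemma cscaleA (V : normedModType R) (l m : R[i]) (z : V * V) :
  cscale l (cscale m z) = cscale (l * m) z.
Proof.
case: l m z => [a b] [c d] [x y]; rewrite /cscale /=; congr (_, _).
- rewrite !scalerBr !scalerDr !scalerA scalerBl scalerDl !opprD -!addrA.
  by congr (_ + _); rewrite addrCA.
- rewrite !scalerBr !scalerDr !scalerA scalerBl scalerDl -!addrA.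
  by rewrite [RHS]addrCA; congr (_ + _); rewrite addrC -addrA.
Qed.

Lemma cscale1 (V : normedModType R) (z : V * V) : cscale 1 z = z.
Proof. by case: z => x y; rewrite /cscale /= !scale1r !scale0r subr0 add0r. Qed.

Lemma cscale_linear (V : normedModType R) (l : R[i]) : linear (@cscale R V l).
Proof.
move=> a [x y] [x' y']; rewrite /cscale /=; congr (_, _).
  rewrite [RHS]/= !scalerDr opprD addrACA scalerN !scalerA.
  by congr (_ *: _ - _ *: _ + _); exact: mulrC.
rewrite [RHS]/= !scalerDr addrACA !scalerA.
by congr (_ *: _ + _ *: _ + _); exact: mulrC.
Qed.

Lemma complexify_cscale (V : normedModType R) (T : 'L(V, V)) (l : R[i]) z :
  complexify T (cscale l z) = cscale l (complexify T z).
Proof. by rewrite /complexify /cscale /= linearB linearD !linearZ_LR. Qed.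

Lemma cscale_blin (V : normedModType R) (l : R[i]) :
  @cscale R V l \in @blin_pred R (V * V)%type (V * V)%type.
Proof.
apply/blin_predP; split; first exact: cscale_linear.
move=> z; apply: cvg_pair => /=.
  apply: cvgB; apply: cvgZl_tmp; [exact: cvg_fst|exact: cvg_snd].
apply: cvgD; apply: cvgZl_tmp; [exact: cvg_fst|exact: cvg_snd].
Qed.

Lemma complexify_blin (V : normedModType R) (T : 'L(V, V)) :
  complexify T \in @blin_pred R (V * V)%type (V * V)%type.
Proof.
apply/blin_predP; split.
  by move=> a [x y] [x' y']; rewrite /complexify /= !linearP.
move=> z; apply: cvg_pair => /=.
  by apply: cvg_comp; [exact: cvg_fst|exact: blin_continuous].
by apply: cvg_comp; [exact: cvg_snd|exact: blin_continuous].
Qed.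

Definition cscaleL (V : normedModType R) (l : R[i]) :
  'L((V * V)%type, (V * V)%type) := Blin (cscale_blin V l).

Definition complexifyL (V : normedModType R) (T : 'L(V, V)) :
  'L((V * V)%type, (V * V)%type) := Blin (complexify_blin T).

(** If [S = (l - F G)^-1] then [(l - G F)^-1 = l^-1 (1 + G S F)]. *)
Lemma resolvent_set_comp (V : normedModType R) (F G : 'L(V, V)) (l : R[i]) :
  l != 0 -> resolvent_set (F \oL G) l -> resolvent_set (G \oL F) l.
Proof.
move=> l0 [S [SK KS]].
pose S' := cscaleL V l^-1 \oL
  (cscaleL V 1 + (complexifyL G \oL S \oL complexifyL F)).
have S'E z : S' z = cscale l^-1 (z + complexify G (S (complexify F z))).
  by rewrite -[X in X + _](cscale1 z).
have FGE z : complexify (G \oL F) z = complexify G (complexify F z) by [].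
have cxB (T : 'L(V, V)) z w :
    complexify T (z - w) = complexify T z - complexify T w.
  exact: (linearB (complexifyL T)).
have cxD (T : 'L(V, V)) z w :
    complexify T (z + w) = complexify T z + complexify T w.
  exact: (linearD (complexifyL T)).
exists S'; split=> z; rewrite !S'E.
- rewrite cxB complexify_cscale FGE (SK (complexify F z)) subrK cscaleA.
  by rewrite mulVf // cscale1.
- set w := complexify F z.
  have FG_S : complexify F (complexify G (S w)) = cscale l (S w) - w.
    by rewrite -[X in _ - X](KS w) opprB [RHS]addrC subrK.
  rewrite cscaleA mulfV // cscale1 FGE 2!complexify_cscale !cxD -/w.
  rewrite FG_S cxB complexify_cscale [complexify G w + _]addrC subrK.
  by rewrite cscaleA mulVf // cscale1 addrK.
Qed.

(** The spectra of [F G] and [G F] may differ in [0].  Adjoining [0] to both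
    makes them equal without changing their [sup], even when the set is empty
    or unbounded: there [sup] is [0]. *)
Lemma sup_setU0 (A : set R) : (forall x, A x -> 0 <= x) -> sup (0 |` A) = sup A.
Proof.
move=> A0; have [[a Aa]|/nonemptyPn ->] := pselect (A !=set0); last first.
  by rewrite setU0 sup1 sup0.
have [ubA|nubA] := pselect (has_ubound A).
  by rewrite sup_setU // => [|x y /= -> /A0 //]; split=> //; exists a.
rewrite !sup_out //; first by case.
by case=> _ [M ubM]; apply: nubA; exists M => x Ax; apply: ubM; right.
Qed.

Lemma spectral_radius_comp (V : normedModType R) (F G : 'L(V, V)) :
  spectral_radius (F \oL G) = spectral_radius (G \oL F).
Proof.
pose spec (T : 'L(V, V)) := [set ComplexField.Normc.normc l | l in spectrum T].
have spec_ge0 T x : spec T x -> 0 <= x.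
  by case=> -[a b] _ <-; exact: sqrtr_ge0.
have subspec F' G' : 0 |` spec (F' \oL G') `<=` 0 |` spec (G' \oL F').
  move=> _ [->|[l Fl <-]]; first by left.
  have [->|l0] := eqVneq l 0; first by left; exact: ComplexField.Normc.normc0.
  right; exists l => // Gl; apply: Fl; exact: resolvent_set_comp Gl.
rewrite /spectral_radius -/(spec (F \oL G)) -/(spec (G \oL F)).
rewrite -sup_setU0; last exact: spec_ge0.
rewrite -[RHS]sup_setU0; last exact: spec_ge0.
by congr sup; apply/seteqP; split; exact: subspec.
Qed.

End SpectralRadius.

(** * Hilbert space geometry *)

Section Hilbert.
Context (R : realType) (V : hilbertType R).

Lemma dotDr (x y z : V) : dot x (y + z) = dot x y + dot x z.
Proof. by rewrite dotC dotDl !(dotC x). Qed.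

Lemma dotZr (a : R) (x y : V) : dot x (a *: y) = a * dot x y.
Proof. by rewrite dotC dotZl dotC. Qed.

Lemma dot0r (x : V) : dot x 0 = 0.
Proof. by rewrite -(scale0r x) dotZr mul0r. Qed.

Lemma dotNr (x y : V) : dot x (- y) = - dot x y.
Proof. by rewrite -scaleN1r dotZr mulN1r. Qed.

Lemma dot_le_norm (x y : V) : dot x y <= `|x| * `|y|.
Proof.
have [->|x0] := eqVneq x 0; first by rewrite dotC dot0r normr0 mul0r.
have [->|y0] := eqVneq y 0; first by rewrite dot0r normr0 mulr0.
have xy_gt0 : 0 < `|x| * `|y| by rewrite mulr_gt0 ?normr_gt0.
(* Expanding this square gives [2 |x| |y| (|x| |y| - dot x y) >= 0]. *)
have : 0 <= dot (`|y| *: x - `|x| *: y) (`|y| *: x - `|x| *: y).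
  by rewrite dot_norm exprn_ge0.
rewrite !(dotDl, dotDr) -!scaleNr !(dotZl, dotZr) !dot_norm (dotC y x).
set a := `|x| in xy_gt0 *; set b := `|y| in xy_gt0 *; set d := dot x y => pos.
have : 0 <= a * b * (a * b - d) by lra.
by rewrite pmulr_rge0 // subr_ge0.
Qed.

Lemma normr_dot_le (x y : V) : `|dot x y| <= `|x| * `|y|.
Proof.
rewrite ler_norml dot_le_norm andbT lerNl -dotNr -(normrN y).
exact: dot_le_norm.
Qed.

Lemma dot_blin (w : V) : dot w \in @blin_pred R V R.
Proof.
have lin : linear (dot w : V -> R) by move=> a x y; rewrite dotDr dotZr.
apply/blin_predP; split => //.
pose dotw : {linear V -> R} :=
  HB.pack (dot w : V -> R) (GRing.isLinear.Build R _ _ _ _ lin).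
apply: (@bounded_linear_continuous R _ _ dotw); apply/linear_boundedP.
exists `|w|; split => [|M wM x]; first exact: num_real.
by apply: le_trans (normr_dot_le w x) _; rewrite ler_wpM2r // ltW.
Qed.

Definition riesz (w : V) : 'L(V, R) := Blin (dot_blin w).

Lemma riesz_linear : linear riesz.
Proof.
by move=> a u v; apply: blinP => x; rewrite /riesz /= /blin_fun /= dotDl dotZl.
Qed.

HB.instance Definition _ :=
  GRing.isLinear.Build R V 'L(V, R) _ riesz riesz_linear.

Lemma norm_riesz (w : V) : `|riesz w| = `|w|.
Proof.
apply/eqP; rewrite eq_le; apply/andP; split.
  by apply: opnorm_le => // x; exact: normr_dot_le.
have [->|w0] := eqVneq w 0; first by rewrite normr0.
have := le_opnorm (riesz w) w.
have -> : riesz w w = `|w| ^+ 2 by exact: dot_norm.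
by rewrite ger0_norm ?exprn_ge0 // expr2 ler_pM2r ?normr_gt0.
Qed.

Lemma differentiable_gradient (f : V -> R) (grad : V -> V) (x : V) :
  (forall y, differentiable f y) -> is_gradient f grad ->
  differentiable (fderiv f) x -> differentiable grad x.
Proof.
move=> df f_grad ddf; apply: (isometry_reflects_differentiable norm_riesz).
suff -> : riesz \o grad = fderiv f by [].
apply/funext => y; apply: blinP => h.
by rewrite fderivE // f_grad.
Qed.

Lemma orthogonal_projection_id (E : set V) (P : 'L(V, V)) (u : V) :
  closed_subspace E -> orthogonal_projection E P -> E u -> P u = u.
Proof.
move=> [_ EP _] projP Eu; have [EPu orth] := projP u.
apply/esym/eqP; rewrite -subr_eq0 -normr_eq0 -sqrf_eq0 -dot_norm.
by rewrite {}orth // addrC -scaleN1r; exact: EP.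
Qed.

Lemma closed_subspaceB (E : set V) (u v : V) :
  closed_subspace E -> E u -> E v -> E (u - v).
Proof. by move=> [_ EP _] Eu Ev; rewrite addrC -scaleN1r; exact: EP. Qed.

Lemma closed_subspaceN (E : set V) (u : V) :
  closed_subspace E -> E u -> E (- u).
Proof.
by move=> clE Eu; rewrite -sub0r; apply: closed_subspaceB => //; case: clE.
Qed.

(** * The derivative of one step at a fixed point *)

Section Step.
Variables (E : V -> set V) (P : V -> 'L(V, V)) (S grad : V -> V) (x : V).
Hypothesis E_closed : forall y, closed_subspace (E y).
Hypothesis P_proj : forall y, orthogonal_projection (E y) (P y).
Hypothesis S_step : forall y, (exists2 t, E y t & S y = y + t) /\
                              P y (grad (S y)) = 0.
Hypothesis S_fix : S x = x.
Hypothesis dP : differentiable P x.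
Hypothesis dS : differentiable S x.
Hypothesis dgrad : differentiable grad x.

(** The displacement [v = S - id] satisfies [v y = P y (v y)] everywhere and
    [v x = 0], so the product rule leaves [dv h = P x (dv h)]. *)
Lemma fderiv_step_mem h : E x (fderiv S x h - h).
Proof.
have [v vE] : exists v : V -> V, v = S - id by exists (S - id).
have [dv diff_v] : is_diff x v (('d S x : V -> V) - id).
  by rewrite vE; exact: (is_diffB (differentiableP dS) (is_diff_id x)).
have v_fix y : v y = P y (v y).
  have [[t Et Sy] _] := S_step y.
  have -> : v y = t by rewrite vE !fctE Sy addrC addKr.
  by rewrite (orthogonal_projection_id (E_closed y)).
have vx0 : v x = 0 by rewrite vE !fctE S_fix subrr.
have dvE : fderiv v x h = fderiv S x h - h.
  transitivity ('d v x h); first exact: fderiv_app.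
  transitivity ('d S x h - h); first exact: (congr1 (fun F => F h) diff_v).
  by congr (_ - _); apply/esym/fderiv_app.
rewrite -dvE.
rewrite (fderiv_blin_app h dP dv dv v_fix) vx0 linear0 add0r.
by case: (P_proj x (fderiv v x h)).
Qed.

Lemma fderiv_step_stationary h :
  fderiv P x h (grad x) + P x (fderiv grad x (fderiv S x h)) = 0.
Proof.
have dgradS : differentiable grad (S x) by rewrite S_fix.
have dgS : differentiable (grad \o S) x by exact: differentiable_comp.
have d0 : differentiable (cst 0 : V -> V) x by exact: differentiable_cst.
have stationary y : cst 0 y = P y ((grad \o S) y) by case: (S_step y) => _ ->.
have := fderiv_blin_app h dP dgS d0 stationary.
rewrite fderiv_cst (fderiv_comp dS dgradS) => /esym.
by rewrite /= S_fix.
Qed.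

End Step.

(** [D] stands for the derivative of the step, [A] for the Hessian and [N] for
    the derivative of the projection applied to the gradient.  Keeping only the
    two linearized identities between them makes this part linear algebra. *)
Section LinearizedStep.
Variables (E : set V) (P A B D N : 'L(V, V)).
Hypothesis E_closed : closed_subspace E.
Hypothesis P_proj : orthogonal_projection E P.
Hypothesis B_inv : inverse_on E (P \oL A \oL P) B.
Hypothesis D_mem : forall h, E (D h - h).
Hypothesis D_stationary : forall h, N h + P (A (D h)) = 0.

Let P_mem h : E (P h). Proof. by case: (P_proj h). Qed.
Let P_id u : E u -> P u = u. Proof. exact: orthogonal_projection_id. Qed.

Lemma linearized_shift_mem h : E (N h).
Proof.
have /eqP := D_stationary h; rewrite addr_eq0 => /eqP ->.
exact: closed_subspaceN.
Qed.

Lemma linearized_correction_mem h : E ((B \oL N) h).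
Proof. by case: (B_inv (linearized_shift_mem h)). Qed.

Lemma energy_projection_mem h : E ((B \oL P \oL A) h).
Proof. by case: (B_inv (P_mem (A h))). Qed.

Lemma energy_projection_id u : E u -> (B \oL P \oL A) u = u.
Proof.
move=> Eu; transitivity (B (P (A u))); first by [].
have [_ BMu _] := B_inv Eu.
by rewrite -[RHS]BMu -[in LHS](P_id Eu).
Qed.

(** With [t = D h - h] in [E], stationarity reads
    [P A P t = - (P A h + N h)]; applying [B] recovers [t]. *)
Lemma linearized_stepE h : D h = h - (B \oL P \oL A) h - (B \oL N) h.
Proof.
have [t Dt Et] : exists2 t, D h = h + t & E t.
  by exists (D h - h); rewrite // addrC subrK.
have [_ BMt _] := B_inv Et.
have Mt : (P \oL A \oL P) t = - (P (A h) + N h).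
  transitivity (P (A (P t))); first by [].
  rewrite (P_id Et); have := D_stationary h; rewrite Dt !blinD => Nh.
  apply/eqP; rewrite -addr_eq0 addrA addrC [X in N h + X]addrC; exact/eqP.
by rewrite Dt -addrA -BMt Mt blinN blinD opprD.
Qed.

End LinearizedStep.

(** * Two alternating steps with commuting projections *)

Section TwoSteps.
Variables (E1 E2 : set V) (Q1 Q2 : 'L(V, V)).
Hypothesis E2_closed : closed_subspace E2.
Hypothesis Q1_id : forall u, E1 u -> Q1 u = u.
Hypothesis Q2_mem : forall u, E2 (Q2 u).
Hypothesis Q2_id : forall u, E2 u -> Q2 u = u.
Hypothesis Q_comm : Q1 \oL Q2 = Q2 \oL Q1.

(** For [u = u1 + u2] the remainder is [u2 - Q1 u2], and
    [Q1 u2 = Q1 (Q2 u2) = Q2 (Q1 u2)] lies in [E2]. *)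
Lemma sub_commuting_projection_mem u :
  subspace_sum E1 E2 u -> E2 (u - Q1 u).
Proof.
move=> [u1 Eu1 [u2 Eu2 <-]].
have -> : u1 + u2 - Q1 (u1 + u2) = u2 - Q1 u2.
  by rewrite blinD (Q1_id Eu1) opprD addrACA subrr add0r.
apply: closed_subspaceB => //.
have -> : Q1 u2 = (Q2 \oL Q1) u2 by rewrite -Q_comm -{1}(Q2_id Eu2).
exact: Q2_mem.
Qed.

End TwoSteps.

(** On [E1 + E2] commutation gives [D2 D1 = (M2 + Q2 - 1) M1].  The operators
    [F] and [G] of the proof are [M2 + Q2 - 1] and [M1], precomposed with
    [P]. *)
Lemma spectral_radius_two_steps (E1 E2 : set V)
    (P Q1 Q2 M1 M2 D1 D2 : 'L(V, V)) :
  closed_subspace E1 -> closed_subspace E2 ->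
  (forall h, subspace_sum E1 E2 (P h)) ->
  (forall u, subspace_sum E1 E2 u -> P u = u) ->
  (forall u, E1 (Q1 u)) -> (forall u, E2 (Q2 u)) ->
  (forall u, E1 u -> Q1 u = u) -> (forall u, E2 u -> Q2 u = u) ->
  (forall u, E1 (M1 u)) -> (forall u, E2 (M2 u)) ->
  (forall u, E1 u -> M1 u = 0) -> (forall u, E2 u -> M2 u = 0) ->
  Q1 \oL Q2 = Q2 \oL Q1 ->
  (forall h, D1 h = h - Q1 h - M1 h) -> (forall h, D2 h = h - Q2 h - M2 h) ->
  spectral_radius (D2 \oL D1 \oL P) = spectral_radius (M2 \oL M1 \oL P).
Proof.
move=> clE1 clE2 P_mem P_id Q1_mem Q2_mem Q1_id Q2_id M1_mem M2_mem M1_0 M2_0.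
move=> Q_comm D1E D2E.
have sum1 u : E1 u -> subspace_sum E1 E2 u.
  by move=> Eu; exists u => //; exists 0; [case: clE2|rewrite addr0].
have PM1 h : P (M1 h) = M1 h by exact/P_id/sum1.
have sumC u : subspace_sum E1 E2 u -> subspace_sum E2 E1 u.
  by move=> [u1 Eu1 [u2 Eu2 <-]]; exists u2 => //; exists u1; rewrite // addrC.
have rem1 h : E2 (P h - Q1 (P h)).
  exact: (sub_commuting_projection_mem clE2 Q1_id Q2_mem Q2_id Q_comm).
have rem2 h : E1 (P h - Q2 (P h)).
  apply: (sub_commuting_projection_mem clE1 Q2_id Q1_mem Q1_id (esym Q_comm)).
  exact: sumC.
pose F := ((M2 + Q2) \oL P) - P; pose G := M1 \oL P.
have FE u : subspace_sum E1 E2 u -> F u = M2 u + Q2 u - u.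
  move=> /P_id Pu.
  transitivity (M2 (P u) + Q2 (P u) - P u); first by [].
  by rewrite Pu.
transitivity (spectral_radius (F \oL G)).
  congr spectral_radius; apply: blinP => h.
  transitivity (D2 (D1 (P h))); first by [].
  transitivity (F (M1 (P h))); last by [].
  rewrite (FE _ (sum1 _ (M1_mem (P h)))) D1E D2E.
  have := rem1 h; move: (P h - Q1 (P h)) => r Er.
  have regroup (a b m : V) : r - m - (r - b) - (0 - a) = a + b - m.
    rewrite sub0r opprK opprB [r - m + _]addrC addrA subrK addrAC.
    by rewrite [b + a]addrC.
  rewrite !blinB (Q2_id _ Er) (M2_0 _ Er); exact: regroup.
rewrite spectral_radius_comp.
transitivity (spectral_radius (G \oL (M2 \oL P))).
  congr spectral_radius; apply: blinP => h.
  transitivity (M1 (P (F h))); first by [].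
  transitivity (M1 (P (M2 (P h)))); last by [].
  have -> : F h = M2 (P h) - (P h - Q2 (P h)).
    transitivity (M2 (P h) + Q2 (P h) - P h); first by [].
    by rewrite opprB addrA.
  have := rem2 h; move: (P h - Q2 (P h)) => r Er.
  by rewrite !blinB (P_id _ (sum1 _ Er)) (M1_0 _ Er) subr0.
rewrite spectral_radius_comp; congr spectral_radius; apply: blinP => h.
transitivity (M2 (P (M1 (P h)))); first by [].
by rewrite PM1.
Qed.

End Hilbert.

Theorem theorem2p5 (R : realType) (V : hilbertType R)
  (f : V -> R) (grad : V -> V)
  (f_C1 : forall x, C1_at f x)
  (f_grad : is_gradient f grad)
  (T1 T2 T : V -> set V)
  (T1_closed : forall x, closed_subspace (T1 x))
  (T2_closed : forall x, closed_subspace (T2 x))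
  (T_sum : forall x, T x = subspace_sum (T1 x) (T2 x))
  (T_closed : forall x, closed_subspace (T x))
  (P1 P2 P : V -> 'L(V, V))
  (P1_proj : forall x, orthogonal_projection (T1 x) (P1 x))
  (P2_proj : forall x, orthogonal_projection (T2 x) (P2 x))
  (P_proj : forall x, orthogonal_projection (T x) (P x))
  (S1 S2 : V -> V)
  (S1_step : forall x, (exists2 t, T1 x t & S1 x = x + t) /\
                       P1 x (grad (S1 x)) = 0)
  (S2_step : forall x, (exists2 t, T2 x t & S2 x = x + t) /\
                       P2 x (grad (S2 x)) = 0)
  (xbar : V)
  (S1_fix : S1 xbar = xbar)
  (S2_fix : S2 xbar = xbar)
  (P1_C1 : C1_near P1 xbar)
  (P2_C1 : C1_near P2 xbar)
  (S1_C1 : C1_near S1 xbar)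
  (S2_C1 : C1_near S2 xbar)
  (f_C2 : C2_near f xbar)
  (B1 B2 : 'L(V, V)) :
  let A := fderiv grad xbar in
  let PA1 := B1 \oL P1 xbar \oL A in
  let PA2 := B2 \oL P2 xbar \oL A in
  let N1 := blin_eval V (grad xbar) \oL fderiv P1 xbar in
  let N2 := blin_eval V (grad xbar) \oL fderiv P2 xbar in
  inverse_on (T1 xbar) (P1 xbar \oL A \oL P1 xbar) B1 ->
  inverse_on (T2 xbar) (P2 xbar \oL A \oL P2 xbar) B2 ->
  PA1 \oL PA2 = PA2 \oL PA1 ->
  (forall h, T1 xbar h -> N1 h = 0) ->
  (forall h, T2 xbar h -> N2 h = 0) ->
  spectral_radius (fderiv (S2 \o S1) xbar \oL P xbar) =
  spectral_radius (B2 \oL N2 \oL B1 \oL N1 \oL P xbar).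
Proof.
move=> A PA1 PA2 N1 N2 B1_inv B2_inv PA_comm N1_0 N2_0.
have dP1 : differentiable P1 xbar by case: (nbhs_singleton P1_C1).
have dP2 : differentiable P2 xbar by case: (nbhs_singleton P2_C1).
have dS1 : differentiable S1 xbar by case: (nbhs_singleton S1_C1).
have dS2 : differentiable S2 xbar by case: (nbhs_singleton S2_C1).
have dgrad : differentiable grad xbar.
  apply: (differentiable_gradient (f := f)) => //.
    by move=> y; case: (f_C1 y).
  by case: f_C2 => _ /nbhs_singleton[].
have D1_mem := fderiv_step_mem T1_closed P1_proj S1_step S1_fix dP1 dS1.
have D2_mem := fderiv_step_mem T2_closed P2_proj S2_step S2_fix dP2 dS2.
have D1_st : forall h, N1 h + P1 xbar (A (fderiv S1 xbar h)) = 0 :=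
  fderiv_step_stationary S1_step S1_fix dP1 dS1 dgrad.
have D2_st : forall h, N2 h + P2 xbar (A (fderiv S2 xbar h)) = 0 :=
  fderiv_step_stationary S2_step S2_fix dP2 dS2 dgrad.
have dS2' : differentiable S2 (S1 xbar) by rewrite S1_fix.
rewrite (fderiv_comp dS1 dS2') S1_fix.
have P_mem h : subspace_sum (T1 xbar) (T2 xbar) (P xbar h).
  by rewrite -T_sum; case: (P_proj xbar h).
have P_id u : subspace_sum (T1 xbar) (T2 xbar) u -> P xbar u = u.
  by rewrite -T_sum; exact: orthogonal_projection_id.
transitivity (spectral_radius ((B2 \oL N2) \oL (B1 \oL N1) \oL P xbar));
  last by congr spectral_radius; apply: blinP.
apply: (@spectral_radius_two_steps _ _ (T1 xbar) (T2 xbar) _ PA1 PA2) => //.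
- exact: energy_projection_mem.
- exact: energy_projection_mem.
- exact: energy_projection_id.
- exact: energy_projection_id.
- exact: (linearized_correction_mem (T1_closed xbar) (P1_proj xbar)
            B1_inv D1_st).
- exact: (linearized_correction_mem (T2_closed xbar) (P2_proj xbar)
            B2_inv D2_st).
- by move=> u /N1_0 N1u; transitivity (B1 (N1 u)); [|rewrite N1u linear0].
- by move=> u /N2_0 N2u; transitivity (B2 (N2 u)); [|rewrite N2u linear0].
- exact: (linearized_stepE (T1_closed xbar) (P1_proj xbar) B1_inv D1_mem D1_st).
- exact: (linearized_stepE (T2_closed xbar) (P2_proj xbar) B2_inv D2_mem D2_st).
Qed.
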